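(* For every positive integer $c$ there exists a real number $d$ with $0<d\le 1$ such that for every integer $n\ge 1$ $$\lfloor dn\rfloor!\le M(n,c\mathbb{N}),$$ where $c\mathbb{N}$ denotes the set of positive integers divisible by $c$.
   Context: $K_n$ is the complete graph on the vertex set $\{1,\dots,n\}$. Hamiltonian paths of $K_n$ are undirected and are regarded as (labelled) subgraphs of $K_n$. For a set $\mathbb{D}\subseteq\mathbb{N}$, two Hamiltonian paths in $K_n$ are called $\mathbb{D}$-cycle different if the union of the two paths (the graph whose edge set is the union of their edge sets) contains a cycle, not necessarily induced, whose length belongs to $\mathbb{D}$. $M(n,\mathbb{D})$ denotes the largest cardinality of a set of Hamiltonian paths in $K_n$ any two distinct members of which are $\mathbb{D}$-cycle different. *)

(* Defs.v *)
From mathcomp Require Import all_boot all_fingroup.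

Set Implicit Arguments.
Unset Strict Implicit.
Unset Printing Implicit Defensive.

(* The vertex set {1, ..., n} of K_n is modelled by 'I_n.  A spanning subgraph
   of K_n is identified with its edge set, a set of two-element sets of
   vertices, so that the union of two graphs is the union of edge sets. *)
Definition subgraph (n : nat) := {set {set 'I_n}}.

Definition adj (n : nat) (G : subgraph n) : rel 'I_n :=
  [rel x y | [set x; y] \in G].

(* The Hamiltonian path visiting s 0, s 1, ..., s (n - 1) in this order.
   A permutation and its reversal yield the same (undirected) path. *)
Definition perm_path (n : nat) (s : 'S_n) : subgraph n :=
  [set [set s p.1; s p.2] | p : 'I_n * 'I_n & p.2 == p.1.+1 :> nat].

Definition ham_paths (n : nat) : {set subgraph n} :=
  [set perm_path s | s : 'S_n].

(* Graphs are simple, so a cycle has at least 3 vertices; in particular an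
   edge shared by the two paths is not a cycle of length 2.  The bound k <= n
   on the length of a cycle loses nothing since its vertices are distinct. *)
Definition has_cycle_in (D : pred nat) (n : nat) (G : subgraph n) : bool :=
  [exists k : 'I_n.+1, [&& D k, 2 < k &
     [exists t : k.-tuple 'I_n, ucycleb (adj G) t]]].

Definition cycle_different (D : pred nat) (n : nat) (P Q : subgraph n) : bool :=
  has_cycle_in D (P :|: Q).

Definition pairwise_cycle_different (D : pred nat) (n : nat)
    (F : {set subgraph n}) : bool :=
  [forall P in F, forall Q in F, (P != Q) ==> cycle_different D P Q].

Definition M (n : nat) (D : pred nat) : nat :=
  \max_(F : {set subgraph n} | (F \subset ham_paths n) &&
                               pairwise_cycle_different D F) #|F|.

Definition positive_multiples (c : nat) : pred nat :=
  [pred l | (0 < l) && (c %| l)].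

(* Main.v *)
Require Import Defs.
From mathcomp Require Import all_boot all_order all_algebra.
From mathcomp Require Import all_fingroup.
From mathcomp Require Import reals.
Import Order.TTheory GRing.Theory Num.Theory.
Local Open Scope ring_scope.

(** Fix k >= 3 and call a permutation s of the vertices residue-preserving when
    s p and p agree modulo k for every position p.  The path of such an s can
    be oriented without knowing s: along it residues modulo k grow by one at
    each step, and since 1 and -1 differ modulo k, an edge can be oriented in
    that way in only one direction ([step_perm_path]).

    Let s and t be two distinct residue-preserving permutations, and p the
    first position at which they differ.  The path of s visits s p before t p,
    the path of t visits t p before s p, so the oriented union of the two paths
    contains a closed walk, hence a directed simple cycle.  Residues grow by one
    at each step of it, so its length is a multiple of k
    ([cycle_different_perm_path]); being positive it is at least k >= 3.
    If the two paths coincided, this closed walk would lie inside a single path,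
    where each step raises the position; so distinct
    residue-preserving permutations also give distinct paths
    ([perm_path_residue_inj]).

    Permutations moving only the multiples of k are residue-preserving, and
    there are at least (n %/ k)! of them.  The theorem follows with k = 3 * c
    and d = 1 / k, as multiples of 3 * c are multiples of c. *)

(** Closing a duplicate-free path from the successor z of x back to x with the
    edge from x to z gives the cycle. *)
Lemma ucycle_of_connect (T : finType) (e : rel T) (x y : T) :
  x != y -> connect e x y -> connect e y x ->
  exists z p, ucycle e (z :: p).
Proof.
move=> neq_xy /connectP[[|z p] /= xp y_last] yx.
  by rewrite y_last eqxx in neq_xy.
have /andP[xz zp] := xp.
have /connectP[q0 zq0 x_last0] : connect e z x.
  by apply: connect_trans yx; apply/connectP; exists p.
case/shortenP: zq0 x_last0 => q zq uniq_q _ x_last.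
exists z, q; rewrite /ucycle uniq_q andbT.
by rewrite /= rcons_path zq -x_last.
Qed.

Section ResiduePreserving.

Variables (k n : nat).
Implicit Types (s t : 'S_n) (p q x y : 'I_n) (G H : subgraph n).

Definition step G : rel 'I_n :=
  [rel x y | adj G x y && (y == x.+1 %[mod k])%N].

Definition residue_preserving s := forall p, (s p = p %[mod k])%N.

Lemma connect_step_subset G H :
  G \subset H -> subrel (connect (step G)) (connect (step H)).
Proof.
move=> /subsetP GH; apply: connect_sub => x y /andP[/GH Hxy xy].
by apply/connect1/andP.
Qed.

Lemma step_path_last G x (w : seq 'I_n) :
  path (step G) x w -> (last x w = x + size w %[mod k])%N.
Proof.
elim: w x => [|y w IHw] x /=; first by rewrite addn0.
case/andP=> /andP[_ /eqP xy] /IHw ->.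
by rewrite -modnDml xy modnDml addSnnS.
Qed.

Lemma dvdn_size_step_cycle G (w : seq 'I_n) :
  path.cycle (step G) w -> (k %| size w)%N.
Proof.
case: w => [|x w] //= /step_path_last /eqP.
by rewrite last_rcons size_rcons -{1}[val x]addn0 eqn_modDl mod0n eq_sym.
Qed.

Lemma adj_perm_path s p q :
  adj (perm_path s) (s p) (s q) = (q == p.+1 :> nat) || (p == q.+1 :> nat).
Proof.
apply/imsetP/orP => [[[a b]] /= | [] pq]; last 2 first.
- by exists (p, q); rewrite ?inE.
- by exists (q, p); rewrite ?inE // setUC.
rewrite inE /= => /eqP ab edge_eq.
have: (s p \in [set s a; s b]) && (s q \in [set s a; s b]).
  by rewrite -edge_eq set21 set22.
have: (s a \in [set s p; s q]) && (s b \in [set s p; s q]).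
  by rewrite edge_eq set21 set22.
rewrite !inE !(inj_eq perm_inj) => /andP[ap bp] /andP[pa qa].
have /eqP: a != b by apply: contra_eq_neq ab => ->; rewrite neq_ltn leqnn.
case/orP: pa => /eqP pE; case/orP: qa => /eqP qE; subst p q => //.
- by move: bp; rewrite orbb eq_sym => /eqP.
- by left; apply/eqP.
- by right; apply/eqP.
- by move: ap; rewrite orbb => /eqP.
Qed.

Hypothesis k_gt2 : (2 < k)%N.

(** Traversing the edge from s p to s p.+1 backwards lowers residues by one,
    which differs from raising them by one as k does not divide 2. *)
Lemma step_perm_path s p q : residue_preserving s ->
  step (perm_path s) (s p) (s q) = (q == p.+1 :> nat).
Proof.
move=> s_res; rewrite /step /= adj_perm_path.
have -> : (s q == (s p).+1 %[mod k])%N = (q == p.+1 %[mod k])%N.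
  by rewrite s_res -addn1 -modnDml s_res modnDml addn1.
have [-> | neq_qp] /= := eqVneq (val q) p.+1; first by rewrite eqxx.
apply/andP=> -[/eqP ->]; rewrite -[in X in X == _](addn0 (val q)) -addn2.
by rewrite eqn_modDl mod0n modn_small.
Qed.

(** Read from right to left this supplies the two halves of a closed walk; read
    from left to right it forbids one inside a single path. *)
Lemma connect_step_perm_path s p q : residue_preserving s ->
  connect (step (perm_path s)) (s p) (s q) = (p <= q)%N.
Proof.
move=> s_res; apply/idP/idP => [/connectP[w] | ].
  elim: w p => [|x w IHw] p /=; first by move=> _ /perm_inj ->.
  rewrite -(permKV s x) step_perm_path // => /andP[/eqP px xw] q_last.
  by rewrite ltnW // -px IHw.
move: {2}(val q) (erefl (val q)) => m; elim: m q => [|m IHm] q qm.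
  rewrite qm leqn0 => /eqP p0.
  by have -> : p = q by apply/val_inj; rewrite /= p0 qm.
rewrite leq_eqVlt => /predU1P[/val_inj -> // | ].
rewrite qm ltnS => le_pm.
have lt_mn : (m < n)%N by rewrite ltnW // -qm ltn_ord.
apply: connect_trans (IHm (Ordinal lt_mn) erefl le_pm) (connect1 _).
by rewrite step_perm_path //= qm.
Qed.

(** Cutting at the first position where s and t differ: each of s p and t p is
    met by the other path only later on. *)
Lemma perm_inversion s t : s != t ->
  exists x y, (s^-1 x < s^-1 y)%g%N /\ (t^-1 y < t^-1 x)%g%N.
Proof.
move=> neq_st.
have [p0 p0P] : exists p, s p != t p.
  apply/existsP; apply: contraNT neq_st; rewrite negb_exists => /forallP st.
  by apply/eqP/permP => p; apply/eqP; rewrite -[_ == _]negbK.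
case: (@arg_minnP _ p0 (fun p => s p != t p) val p0P) => p neq_p p_min.
have below (u v : 'S_n) : u p != v p ->
    (forall q : 'I_n, (q < p)%N -> u q = v q) -> (p < v^-1%g (u p))%N.
  move=> neq_uv eq_uv; rewrite ltnNge leq_eqVlt negb_or; apply/andP; split.
    by apply: contra_neqN neq_uv => /eqP/val_inj p_eq; rewrite -{2}p_eq permKV.
  apply/negP => lt_p; move: (eq_uv _ lt_p); rewrite permKV => /perm_inj eq_p.
  by rewrite eq_p ltnn in lt_p.
have st_lt (q : 'I_n) : (q < p)%N -> s q = t q.
  by move=> lt_qp; apply/eqP; apply: contraTT lt_qp => /p_min; rewrite -leqNgt.
exists (s p), (t p); split; rewrite permK.
- by apply: below => [|q /st_lt //]; rewrite eq_sym.
- exact: below.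
Qed.

Lemma perm_path_residue_inj s t :
  residue_preserving s -> residue_preserving t ->
  perm_path s = perm_path t -> s = t.
Proof.
move=> s_res t_res eq_st; apply/eqP; apply: contraT.
case/perm_inversion => x [y [lt_xy /ltnW]].
rewrite -(connect_step_perm_path t) // -eq_st !permKV.
rewrite -{1}(permKV s x) -{1}(permKV s y) connect_step_perm_path //.
by rewrite leqNgt lt_xy.
Qed.

Lemma cycle_different_perm_path (D : pred nat) s t :
  (forall l, (0 < l)%N -> (k %| l)%N -> D l) ->
  residue_preserving s -> residue_preserving t -> s != t ->
  cycle_different D (perm_path s) (perm_path t).
Proof.
move=> D_mult s_res t_res /perm_inversion[x [y [lt_s /ltnW le_t]]].
have neq_xy : x != y by apply: contraTneq lt_s => ->; rewrite ltnn.
have xy : connect (step (perm_path s :|: perm_path t)) x y.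
  apply: connect_step_subset (subsetUl _ _) _ _ _.
  by rewrite -(permKV s x) -(permKV s y) connect_step_perm_path // ltnW.
have yx : connect (step (perm_path s :|: perm_path t)) y x.
  apply: connect_step_subset (subsetUr _ _) _ _ _.
  by rewrite -(permKV t x) -(permKV t y) connect_step_perm_path.
have [z [w /andP[step_w uniq_w]]] := ucycle_of_connect _ _ _ _ neq_xy xy yx.
have k_dvd := dvdn_size_step_cycle _ _ step_w.
have size_le : (size (z :: w) < n.+1)%N.
  by rewrite ltnS -[n in leqRHS]card_ord -(card_uniqP uniq_w) max_card.
apply/existsP; exists (Ordinal size_le); apply/and3P; split.
- exact: D_mult.
- exact: leq_trans k_gt2 (dvdn_leq _ k_dvd).
- apply/existsP; exists (in_tuple (z :: w)); rewrite /ucycleb uniq_w andbT.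
  by apply: sub_cycle step_w => u v /andP[].
Qed.

Definition multiples : {set 'I_n} := [set p : 'I_n | (k %| p)%N].

Lemma perm_on_multiples_residue s :
  perm_on multiples s -> residue_preserving s.
Proof.
move=> s_on p.
have [p_mult | /(out_perm s_on) -> //] := boolP (p \in multiples).
have: s p \in multiples by rewrite perm_closed.
by move: p_mult; rewrite !inE => /eqP -> /eqP ->.
Qed.

Lemma leq_card_multiples m : (m * k <= n)%N -> (m <= #|multiples|)%N.
Proof.
move=> le_mk.
have lt_n (i : 'I_m) : (i * k < n)%N.
  by apply: leq_trans le_mk; rewrite ltn_pmul2r // (ltn_trans _ k_gt2).
have inj_mul : injective (fun i : 'I_m => Ordinal (lt_n i)).
  move=> i j /(congr1 val) /= /eqP; rewrite eqn_pmul2r ?(ltn_trans _ k_gt2) //.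
  by move/eqP/val_inj.
rewrite -[leqLHS]card_ord -(card_codom inj_mul); apply/subset_leq_card/subsetP.
by move=> _ /codomP[i ->]; rewrite inE dvdn_mull.
Qed.

Lemma fact_leq_M (D : pred nat) m :
  (forall l, (0 < l)%N -> (k %| l)%N -> D l) ->
  (m * k <= n)%N -> (m`! <= M n D)%N.
Proof.
move=> D_mult /leq_card_multiples le_m.
pose F : {set subgraph n} := [set perm_path s | s in perm_on multiples].
have card_F : #|F| = (#|multiples|)`!.
  rewrite card_in_imset ?card_perm // => s t s_on t_on.
  by apply: perm_path_residue_inj; apply: perm_on_multiples_residue.
apply: (bigop.bigmax_sup F); last by rewrite card_F leq_fact.
apply/andP; split.
  by apply/subsetP => _ /imsetP[s _ ->]; apply: imset_f.
apply/forall_inP => _ /imsetP[s s_on ->].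
apply/forall_inP => _ /imsetP[t t_on ->].
apply/implyP => neq_st; apply: cycle_different_perm_path => //.
- exact: perm_on_multiples_residue.
- exact: perm_on_multiples_residue.
- by apply: contra_neq neq_st => ->.
Qed.

End ResiduePreserving.

Theorem theorem2 (R : realType) (c : nat) (hc : (0 < c)%N) :
  exists d : R, [/\ 0 < d, d <= 1 &
    forall n : nat, (1 <= n)%N ->
      ((Num.truncn (d * n%:R))`! <= M n (positive_multiples c))%N].
Proof.
(* For c = 1 or 2 the modulus c itself would be too small to orient the edges;
   the factor 3 makes it at least 3. *)
have k_gt2 : (2 < 3 * c)%N by rewrite -[3%N in leqLHS]muln1 leq_mul2l.
have k_gt0 : 0 < (3 * c)%:R :> R by rewrite ltr0n (ltn_trans _ k_gt2).
exists (3 * c)%:R^-1; split; first by rewrite invr_gt0.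
  by rewrite invf_le1 // ler1n (ltn_trans _ k_gt2).
move=> n _; apply: (fact_leq_M (3 * c)) => // [l l_gt0 k_dvd | ].
  by rewrite /positive_multiples /= l_gt0 (dvdn_trans _ k_dvd) ?dvdn_mull.
rewrite -(ler_nat R) natrM -ler_pdivlMr // mulrC.
by rewrite truncn_le // mulr_ge0 ?invr_ge0 ?ler0n // ltW.
Qed.
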